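(* Consider an anonymized database $\mathbf{X}$ and a labeled correlated database $\mathbf{Y}$, where the database distribution $p_X$ and the column repetition distribution $p_S$ are unknown to the matching scheme. Suppose there is no obfuscation, i.e. $p_{Y|X}(y|x)=\mathbf{1}_{[y=x]}$ for all $(x,y)\in\mathcal{X}^2$. Then, for any seed size $\Lambda_n$, the distribution-agnostic matching capacity is $$C=(1-\delta)\,H(X),$$ where $\delta=p_S(0)$ is the deletion probability and $H(X)$ is the Shannon entropy of $X\sim p_X$.
   Context: All logarithms are base 2, and entropy is in bits. $[n]=\{1,\dots,n\}$. **Databases.** Let $\mathcal{X}=\{1,\dots,|\mathcal{X}|\}$ be a finite alphabet and $p_X$ a probability distribution with support $\mathcal{X}$. An $(m_n,n,p_X)$ anonymized database is a random $m_n\times n$ matrix $\mathbf{X}=(X_{i,j})$ with i.i.d. entries $X_{i,j}\sim p_X$. The column repetition pattern is $S^n=(S_1,\dots,S_n)$, independent of $\mathbf{X}$, with $S_j$ i.i.d. $\sim p_S$, where $p_S$ has finite integer support $\{0,\dots,s_{\max}\}$. The anonymization function $\sigma_n$ is a uniformly random permutation of $[m_n]$, independent of the rest. The obfuscation distribution $p_{Y|X}$ is a conditional distribution (channel) from $\mathcal{X}$ to $\mathcal{X}$. Put $K_0=0$ and $K_j=\sum_{t=1}^j S_t$. The labeled correlated database $\mathbf{Y}$ is the $m_n\times K_n$ matrix such that, given $\mathbf{X},S^n,\sigma_n$, its entries are conditionally independent and, for every $i\in[m_n]$, $j\in[n]$ and $1\le s\le S_j$, $$Y_{\sigma_n(i),K_{j-1}+s}\sim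 p_{Y|X}(\cdot\mid X_{i,j}).$$ With no obfuscation this means $Y_{\sigma_n(i),K_{j-1}+s}=X_{i,j}$, so column $j$ of $\mathbf{X}$ appears $S_j$ times in $\mathbf{Y}$ (up to the row permutation), and is deleted if $S_j=0$. **Seeds.** A batch of $\Lambda_n$ seeds is a pair of matrices $(\mathbf{G}^{(1)},\mathbf{G}^{(2)})$ of sizes $\Lambda_n\times n$ and $\Lambda_n\times K_n$. The matrix $\mathbf{G}^{(1)}$ has i.i.d. $p_X$ entries, and $\mathbf{G}^{(2)}$ is obtained from $\mathbf{G}^{(1)}$ by the same mechanism, with the same repetition pattern $S^n$ and the channel $p_{Y|X}$, but without any row permutation (row $i$ of $\mathbf{G}^{(2)}$ corresponds to row $i$ of $\mathbf{G}^{(1)}$). The seed rows are additional rows, not part of $\mathbf{X},\mathbf{Y}$: given $S^n$, the pair $(\mathbf{G}^{(1)},\mathbf{G}^{(2)})$ is independent of $(\mathbf{X},\mathbf{Y},\sigma_n)$. **Growth rate.** The database growth rate is $R=\lim_{n\to\infty}\frac1n\log m_n$. It is assumed that $R>0$. **Achievability and capacity.** A matching scheme is a sequence of maps $\psi_n:(\mathbf{X},\mathbf{Y},\mathbf{G}^{(1)},\mathbf{G}^{(2)})\mapsto\hat\sigma_n$ with $\hat\sigma_n:[m_n]\to[m_n]\cup\{0\}$ (value $0$ meaning a declared error). It is distribution-agnostic if it does not rely on any knowledge of $p_X$ and $p_S$. It may use $n$, $m_n$, $\Lambda_n$, $|\mathcal{X}|$, $s_{\max}$ and the following structural facts: the entries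 of $\mathbf{X}$ are i.i.d., the entries of $S^n$ are i.i.d., $\mathbf{X}$ and $S^n$ are independent, $\sigma_n$ is a uniformly random permutation, there is no obfuscation (so that $Y_{\sigma_n(i),K_{j-1}+s}=X_{i,j}$ for all $i\in[m_n]$, $j\in[n]$, $1\le s\le S_j$), and the seeds are generated by the same mechanism with the same $S^n$ and no row permutation. That is, the maps $\psi_n$ are fixed without reference to $(p_X,p_S)$, and the same maps are used whatever these distributions are. For given $(p_X,p_S)$ and seed sizes $\Lambda_n$, a growth rate $R$ is distribution-agnostically achievable if, for databases with row sizes $m_n$ of growth rate $R$, there is a distribution-agnostic matching scheme with $$\lim_{n\to\infty}\Pr\big(\sigma_n(I)\ne\hat\sigma_n(I)\big)=0,$$ where $I$ is uniform on $[m_n]$ and independent of everything else. The distribution-agnostic matching capacity $C$ (for the given $p_X,p_S,\Lambda_n$) is the supremum of all distribution-agnostically achievable growth rates, with the supremum of the empty set taken to be $0$. *)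

(* Defs.v *)
From HB Require Import structures.
From mathcomp Require Import all_boot all_order all_fingroup all_algebra.
From mathcomp Require Import all_classical all_reals all_analysis.
Set Implicit Arguments.
Unset Strict Implicit.
Unset Printing Implicit Defensive.
Import Order.TTheory GRing.Theory Num.Theory numFieldNormedType.Exports.
Local Open Scope classical_set_scope.
Local Open Scope ring_scope.

Definition log2 {R : realType} (x : R) : R := ln x / ln 2.

Definition entropy {R : realType} {T : finType} (p : T -> R) : R :=
  - \sum_x p x * log2 (p x).

Definition full_support_pmf {R : realType} {T : finType} (p : T -> R) : Prop :=
  (forall x, 0 < p x) /\ \sum_x p x = 1.

Definition iid_pmf {R : realType} {T : Type} (p : T -> R) (m n : nat)
    (A : 'M[T]_(m, n)) : R :=
  \prod_(i < m) \prod_(j < n) p (A i j).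

(* S j is the number of copies of column j, a value in {0, ..., smax}. *)
Definition pattern (smax n : nat) := {ffun 'I_n -> 'I_smax.+1}.

(* K_n = S_1 + ... + S_n *)
Definition width (smax n : nat) (S : pattern smax n) : nat :=
  (\sum_(j < n) nat_of_ord (S j))%N.

(* Column index of copy t of column j: its value is
   \sum_(j' < j) S j' + t (see tagnat.RankEsum), i.e. K_{j-1} + t. *)
Definition copy_index (smax n : nat) (S : pattern smax n) (j : 'I_n)
    (t : 'I_(S j)) : 'I_(width S) :=
  tagnat.Rank (p_ := fun j0 : 'I_n => nat_of_ord (S j0)) j t.

(* Conditional probability of the output matrix B given the input matrix A, the
   repetition pattern S and the row permutation s: each B (s i) (copy t of j) is
   drawn from W (A i j), conditionally independently.  Every entry of B occurs
   exactly once in the product. *)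
Definition output_pmf {R : realType} {T : Type} (W : T -> T -> R)
    (smax m n : nat) (S : pattern smax n) (s : 'S_m)
    (A : 'M[T]_(m, n)) (B : 'M[T]_(m, width S)) : R :=
  \prod_(i < m) \prod_(j < n) \prod_(t < S j)
    W (A i j) (B (s i) (copy_index t)).

(* Joint law of (S, X, Y, G1, G2, sigma, I): the pattern, the two databases, the
   two seed matrices (L rows, same pattern, rows not permuted), the uniform
   permutation of the m rows, and the independent uniform row index. *)
Definition joint_pmf {R : realType} (q smax : nat) (W : 'I_q -> 'I_q -> R)
    (pX : 'I_q -> R) (pS : 'I_smax.+1 -> R) (n m L : nat) (S : pattern smax n)
    (X : 'M['I_q]_(m, n)) (Y : 'M['I_q]_(m, width S))
    (G1 : 'M['I_q]_(L, n)) (G2 : 'M['I_q]_(L, width S))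
    (sigma : 'S_m) (i : 'I_m) : R :=
  (\prod_(j < n) pS (S j))
  * (iid_pmf pX X * (m`!%:R)^-1 * output_pmf W sigma X Y)
  * (iid_pmf pX G1 * output_pmf W 1%g G1 G2)
  * m%:R^-1.

(* The map psi_n, as a function of exactly the data a scheme may use: n, m_n,
   Lambda_n, the number K of columns of Y, and the observed matrices
   X, Y, G1, G2 (the alphabet size q, and smax, are fixed beforehand).  No
   distribution is among the arguments.  None stands for a declared error. *)
Definition matching_scheme (q : nat) :=
  forall n m L K : nat,
    'M['I_q]_(m, n) -> 'M['I_q]_(m, K) -> 'M['I_q]_(L, n) -> 'M['I_q]_(L, K) ->
    'I_m -> option 'I_m.

(* Pr (sigma_n(I) <> hat sigma_n(I)) *)
Definition error_prob {R : realType} (q smax : nat) (W : 'I_q -> 'I_q -> R)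
    (pX : 'I_q -> R) (pS : 'I_smax.+1 -> R) (psi : matching_scheme q)
    (n m L : nat) : R :=
  \sum_(S : pattern smax n)
  \sum_(X : 'M['I_q]_(m, n)) \sum_(Y : 'M['I_q]_(m, width S))
  \sum_(G1 : 'M['I_q]_(L, n)) \sum_(G2 : 'M['I_q]_(L, width S))
  \sum_(sigma : 'S_m) \sum_(i < m | psi n m L (width S) X Y G1 G2 i != Some (sigma i))
    joint_pmf W pX pS X Y G1 G2 sigma i.

Definition growth_rate {R : realType} (m : nat -> nat) (r : R) : Prop :=
  (forall n, (0 < m n)%N) /\
  (fun n => log2 (m n)%:R / n%:R : R) @ \oo --> r.

Definition vanishing_error {R : realType} (q smax : nat) (W : 'I_q -> 'I_q -> R)
    (pX : 'I_q -> R) (pS : 'I_smax.+1 -> R) (Lam : nat -> nat)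
    (psi : matching_scheme q) (m : nat -> nat) : Prop :=
  (fun n => error_prob W pX pS psi n (m n) (Lam n)) @ \oo --> (0 : R).

Definition achievable {R : realType} (q smax : nat) (W : 'I_q -> 'I_q -> R)
    (pX : 'I_q -> R) (pS : 'I_smax.+1 -> R) (Lam : nat -> nat) : set R :=
  [set r | 0 < r /\ forall m, growth_rate m r ->
     exists psi, vanishing_error W pX pS Lam psi m].

Definition achieved_by {R : realType} (q smax : nat) (psi : matching_scheme q)
    (W : 'I_q -> 'I_q -> R) (pX : 'I_q -> R) (pS : 'I_smax.+1 -> R)
    (Lam : nat -> nat) : set R :=
  [set r | 0 < r /\ forall m, growth_rate m r ->
     vanishing_error W pX pS Lam psi m].

(* Supremum of a set of positive rates, 0 for the empty set (+oo if unbounded). *)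
Definition rate_sup {R : realType} (A : set R) : \bar R :=
  ereal_sup ([set 0%E] `|` [set r%:E | r in A]).

(* C is the distribution-agnostic capacity, as a function of (pX, pS).  Since
   being distribution-agnostic is a property of one scheme facing all the
   distributions, the scheme of the second clause is quantified before them; the
   first clause says that no scheme, even one tuned to (pX, pS) and m, gets
   beyond C (pX, pS). *)
Definition agnostic_capacity {R : realType} (q smax : nat)
    (W : 'I_q -> 'I_q -> R) (Lam : nat -> nat)
    (C : ('I_q -> R) -> ('I_smax.+1 -> R) -> \bar R) : Prop :=
  (forall pX pS, full_support_pmf pX -> full_support_pmf pS ->
     rate_sup (achievable W pX pS Lam) = C pX pS) /\
  (exists psi : matching_scheme q,
     forall pX pS, full_support_pmf pX -> full_support_pmf pS ->
     rate_sup (achieved_by psi W pX pS Lam) = C pX pS).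

(* Main.v *)
(* Achievability.  The number of occurrences of a letter in a column is not
   changed by permuting the rows, and these numbers are pairwise distinct in the
   columns of X with high probability: an atom of the binomial law B(m, p) has
   mass at most 1 / sqrt (m p (1 - p)) and m_n is exponential in n.  Hence the
   columns of Y reveal from which columns of X they come, and row i is
   identified as soon as no other row of X has the same surviving letters.  By
   the weak law of large numbers these letters carry about n (1 - delta) H(X)
   bits, so a union bound over the rows gives every rate below (1 - delta) H(X).
   The seeds are not used.

   Converse.  Given X, S, Y and the seeds, the rows of X with the same surviving
   letters are interchangeable, so the number of correct guesses is on average
   at most the number of distinct surviving contents.  Up to atypical rows this
   is at most 2 ^ (n ((1 - delta) H(X) + e)), a vanishing fraction of m_n above
   capacity.

   The quantities info and info_rate below are in nats. *)
Require Import Defs.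
From mathcomp Require Import all_boot all_order all_fingroup all_algebra.
From mathcomp Require Import all_classical all_reals all_analysis.
From mathcomp Require Import ring lra.
Set Implicit Arguments.
Unset Strict Implicit.
Unset Printing Implicit Defensive.
Import Order.TTheory GRing.Theory Num.Theory numFieldNormedType.Exports.
Local Open Scope ring_scope.

(** * Product distributions on finite sets *)

Definition prod_pmf {R : realType} {I T : finType} (p : T -> R)
    (f : {ffun I -> T}) : R := \prod_i p (f i).

Definition expect {R : realType} {U : finType} (p : U -> R) (F : U -> R) : R :=
  \sum_u p u * F u.

Definition upd {I T : finType} (f : {ffun I -> T}) (i : I) (t : T) :
  {ffun I -> T} := [ffun k => if k == i then t else f k].

Section Expectation.
Variables (R : realType) (U : finType) (p : U -> R).
Implicit Types (F G : U -> R) (c : R).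

Lemma expectD F G :
  expect p (fun u => F u + G u) = expect p F + expect p G.
Proof.
by rewrite /expect -big_split; apply: eq_bigr => u _; rewrite mulrDr.
Qed.

Lemma expectZ c F : expect p (fun u => c * F u) = c * expect p F.
Proof.
by rewrite /expect big_distrr; apply: eq_bigr => u _; rewrite mulrCA.
Qed.

Lemma expect_sum (J : finType) (P : pred J) (F : J -> U -> R) :
  expect p (fun u => \sum_(j | P j) F j u) = \sum_(j | P j) expect p (F j).
Proof.
rewrite /expect exchange_big; apply: eq_bigr => u _.
by rewrite big_distrr.
Qed.

Lemma eq_expect F G : F =1 G -> expect p F = expect p G.
Proof. by move=> FG; apply: eq_bigr => u _; rewrite FG. Qed.

Hypothesis p_ge0 : forall u, 0 <= p u.

Lemma ler_expect F G : (forall u, F u <= G u) -> expect p F <= expect p G.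
Proof. by move=> FG; apply: ler_sum => u _; rewrite ler_wpM2l. Qed.

Hypothesis p_sum1 : \sum_u p u = 1.

Lemma expect_cst c : expect p (fun=> c) = c.
Proof. by rewrite /expect -big_distrl /= p_sum1 mul1r. Qed.

Lemma expect_ge0 F : (forall u, 0 <= F u) -> 0 <= expect p F.
Proof. by move=> F0; apply: sumr_ge0 => u _; rewrite mulr_ge0. Qed.

End Expectation.

Section ProductPmf.
Variables (R : realType) (I T : finType) (p : T -> R).
Hypothesis p_ge0 : forall t, 0 <= p t.
Hypothesis p_sum1 : \sum_t p t = 1.
Implicit Types (F : {ffun I -> T} -> R) (f : {ffun I -> T}).
Local Notation P := (@prod_pmf R I T p).
Local Notation E := (expect P).

Lemma prod_pmf_ge0 f : 0 <= P f.
Proof. by apply: prodr_ge0 => i _. Qed.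

Lemma prod_pmf_sum1 : \sum_f P f = 1.
Proof.
rewrite /prod_pmf -(bigA_distr_bigA (fun (_ : I) t => p t)).
by rewrite big1 // => i _.
Qed.

(* The involution (f, t) |-> (f[i := t], f i) preserves the product measure. *)
Lemma expect_resample i F :
  E F = E (fun f => expect p (fun t => F (upd f i t))).
Proof.
pose phi (x : {ffun I -> T} * T) := (upd x.1 i x.2, x.1 i).
have phiK : involutive phi.
  move=> [f t]; rewrite /phi /= ffunE eqxx; congr (_, _).
  by apply/ffunP => k; rewrite !ffunE; case: eqP => // ->.
transitivity (\sum_f \sum_t P f * p t * F f).
  apply: eq_bigr => f _; rewrite -big_distrl /= -big_distrr /=.
  by rewrite p_sum1 mulr1.
rewrite /expect; under [RHS]eq_bigr do rewrite big_distrr /=.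
rewrite !pair_bigA /= (reindex_inj (inv_inj phiK)) /=.
apply: eq_bigr => -[f t] _ /=; rewrite mulrA; congr (_ * _).
rewrite /prod_pmf (bigD1 i) //= [in RHS](bigD1 i) //= !ffunE eqxx.
rewrite (eq_bigr (fun k => p (f k))); last first.
  by move=> k /negPf ki; rewrite ffunE ki.
by ring.
Qed.

Lemma expect_marginal i (h : T -> R) : E (fun f => h (f i)) = expect p h.
Proof.
rewrite (expect_resample i).
under eq_expect do under eq_expect do rewrite ffunE eqxx.
by rewrite expect_cst // prod_pmf_sum1.
Qed.

Lemma expect_marginal2 i i' (h : T -> T -> R) : i != i' ->
  E (fun f => h (f i) (f i')) = expect p (fun t => expect p (h t)).
Proof.
move=> ii'; rewrite (expect_resample i').
under eq_expect do under eq_expect do rewrite !ffunE eqxx (negPf ii').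
exact: (expect_marginal i (fun t => expect p (h t))).
Qed.

(** In the expanded square the cross terms vanish, because distinct coordinates are independent and
    [g] is centred. *)
Lemma expect_sqr_sum (g : T -> R) : expect p g = 0 ->
  E (fun f => (\sum_i g (f i)) ^+ 2) =
  #|I|%:R * expect p (fun t => g t ^+ 2).
Proof.
move=> g0.
transitivity (\sum_i \sum_i' E (fun f => g (f i) * g (f i'))).
  rewrite -(eq_bigr _ (fun i _ => expect_sum _ _ _)) -expect_sum.
  apply: eq_expect => f; rewrite expr2 big_distrl /=.
  by apply: eq_bigr => i _; rewrite big_distrr.
rewrite mulr_natl -sumr_const; apply: eq_bigr => i _.
rewrite (bigD1 i) //= big1 ?addr0 => [|i' i'i].
  by rewrite (expect_marginal i (fun t => g t * g t)).
rewrite (expect_marginal2 (fun t t' => g t * g t')); last by rewrite eq_sym.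
under eq_expect do rewrite expectZ g0 mulr0.
by rewrite expect_cst.
Qed.

(** Markov's inequality for the square of the centred sum. *)
Lemma chebyshev_sum (g : T -> R) (a : R) : 0 < a ->
  E (fun f => (a <= `|\sum_i g (f i) - #|I|%:R * expect p g|)%R%:R) <=
  #|I|%:R * expect p (fun t => (g t - expect p g) ^+ 2) / a ^+ 2.
Proof.
move=> a0.
have g0 : expect p (fun t => g t - expect p g) = 0.
  by rewrite expectD expect_cst // subrr.
rewrite -(expect_sqr_sum g0) ler_pdivlMr ?exprn_gt0 // [leLHS]mulrC.
rewrite -(expectZ _ (a ^+ 2)).
apply: ler_expect => [f|f]; first exact: prod_pmf_ge0.
have -> : \sum_i (g (f i) - expect p g) = \sum_i g (f i) - #|I|%:R * expect p g.
  by rewrite sumrB sumr_const mulr_natl.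
case: (leP a) => [le_a|_]; last by rewrite mulr0n mulr0 sqr_ge0.
by rewrite mulr1n mulr1 -[leRHS]real_normK ?num_real // lerXn2r // nnegrE ltW.
Qed.

End ProductPmf.

(** * Atoms of the binomial law *)

Section AntiConcentration.
Variables (R : realType) (I T : finType) (p : T -> R) (a : T).
Hypothesis p_ge0 : forall t, 0 <= p t.
Hypothesis p_sum1 : \sum_t p t = 1.
Local Notation P := (@prod_pmf R I T p).
Local Notation E := (expect P).

Definition occ (f : {ffun I -> T}) : nat := \sum_i (f i == a).

Let occ' (i : I) (f : {ffun I -> T}) : nat := \sum_(k | k != i) (f k == a).

Let occ_upd i f t : occ (upd f i t) = ((t == a) + occ' i f)%N.
Proof.
rewrite /occ (bigD1 i) //= ffunE eqxx; congr addn.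
by apply: eq_bigr => k /negPf ki; rewrite ffunE ki.
Qed.

Let expect_split (F : bool -> R) :
  expect p (fun t => F (t == a)) = p a * F true + (1 - p a) * F false.
Proof.
rewrite /expect (bigD1 a) //= eqxx; congr (_ + _).
rewrite (eq_bigr (fun t => p t * F false)); last by move=> t /negPf ->.
rewrite -big_distrl /=; congr (_ * _).
by rewrite -p_sum1 [in RHS](bigD1 a) //= addrAC subrr add0r.
Qed.

(* Stein's identity for the binomial law, tested against the indicator of
   [k, oo[. *)
Let stein i k :
  E (fun f => ((f i == a)%:R - p a) * (k <= occ f)%:R) =
  p a * (1 - p a) * E (fun f => ((occ' i f).+1 == k)%:R).
Proof.
rewrite (expect_resample p_sum1 i) -expectZ; apply: eq_expect => f.
under eq_expect do rewrite ffunE eqxx occ_upd.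
rewrite (expect_split (fun b => (b%:R - p a) * (k <= b + occ' i f)%:R)).
rewrite add1n add0n (leq_eqVlt k (_.+1)) ltnS eq_sym /=.
case: eqP => [<-|_] /=; last by ring.
by rewrite ltnn !mulr1n !mulr0n; ring.
Qed.

(** Conditioning on coordinate [i]. Both terms have the shape of the right-hand side of [stein], at
    [k] and at [k.+1]. *)
Let occ_split i (k : nat) :
  E (fun f => (occ f == k)%:R) =
  p a * E (fun f => ((occ' i f).+1 == k)%:R) +
  (1 - p a) * E (fun f => ((occ' i f).+1 == k.+1)%:R).
Proof.
rewrite (expect_resample p_sum1 i) -!expectZ -expectD; apply: eq_expect => f.
under eq_expect do rewrite occ_upd.
by rewrite (expect_split (fun b => ((b + occ' i f)%N == k)%:R)) eqSS.
Qed.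

Hypotheses (pa_gt0 : 0 < p a) (pa_lt1 : p a < 1) (I_gt0 : (0 < #|I|)%N).

(** Let [v] be the variance and [c] its square root. Summed over [i], Stein's identity turns the
    atoms of [occ' i] into the mean of [D] on the event [k' <= occ f], which is at most [c] since
    [D] has second moment [v]. By [occ_split], [v] times the atom is a convex combination of two
    such sums, so at most [c]; it remains to divide by [v = c ^+ 2]. *)
Lemma expect_occ_le (k : nat) :
  E (fun f => (occ f == k)%:R) <=
  (Num.sqrt (#|I|%:R * (p a * (1 - p a))))^-1.
Proof.
set v := #|I|%:R * _; set c := Num.sqrt v.
have v0 : 0 < v by rewrite !mulr_gt0 ?ltr0n // subr_gt0.
have c0 : 0 < c by rewrite sqrtr_gt0.
have c2 : c ^+ 2 = v by rewrite sqr_sqrtr // ltW.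
pose D (f : {ffun I -> T}) : R := \sum_i ((f i == a)%:R - p a).
have ED2 : E (fun f => D f ^+ 2) = v.
  pose h (b : bool) : R := b%:R - p a.
  have h0 : expect p (fun t => h (t == a)) = 0.
    by rewrite expect_split /h /=; ring.
  rewrite (expect_sqr_sum I p_sum1 h0) (expect_split (fun b => h b ^+ 2)).
  by rewrite /h /v /=; ring.
have tail k' : \sum_i (p a * (1 - p a) * E (fun f => ((occ' i f).+1 == k')%:R))
    <= c.
  under eq_bigr do rewrite -stein.
  rewrite -expect_sum.
  have -> : c = (2 * c)^-1 * (E (fun f => D f ^+ 2) + E (fun=> c ^+ 2)).
    rewrite ED2 expect_cst ?prod_pmf_sum1 // -c2; field.
    by rewrite gt_eqF.
  rewrite -expectD -expectZ; apply: ler_expect => [f|f].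
    exact: prod_pmf_ge0.
  rewrite -big_distrl /= -/(D f).
  (* AM-GM in place of Cauchy-Schwarz: the bound is nonnegative, so it also holds off the event, and
     its mean is [c]. *)
  have AMGM : D f <= (2 * c)^-1 * (D f ^+ 2 + c ^+ 2).
    rewrite mulrC ler_pdivlMr ?mulr_gt0 //.
    have := sqr_ge0 (D f - c); nra.
  case: (k' <= _)%N; rewrite ?mulr1 // mulr0.
  by rewrite mulr_ge0 ?invr_ge0 ?mulr_ge0 ?addr_ge0 ?sqr_ge0 // ltW.
rewrite -(ler_pM2l v0) -[X in v / X]/c -[in leRHS]c2 expr2 mulfK ?gt_eqF //.
have -> : v * E (fun f => (occ f == k)%:R) =
    \sum_(i : I) p a * (1 - p a) * E (fun f => (occ f == k)%:R).
  by rewrite sumr_const /v -mulr_natl; ring.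
pose A i k' := p a * (1 - p a) * E (fun f => ((occ' i f).+1 == k')%:R).
have -> : \sum_(i : I) p a * (1 - p a) * E (fun f => (occ f == k)%:R) =
    p a * (\sum_i A i k) + (1 - p a) * (\sum_i A i k.+1).
  rewrite [X in _ = X + _]big_distrr [X in _ = _ + X]big_distrr -big_split /=.
  by apply: eq_bigr => i _; rewrite (occ_split i) /A; ring.
apply: (@le_trans _ _ (p a * c + (1 - p a) * c)); last first.
  by rewrite -mulrDl addrC subrK mul1r.
have q_ge0 : 0 <= 1 - p a by rewrite subr_ge0 ltW.
apply: lerD; first exact: (ler_wpM2l (ltW pa_gt0) (tail k)).
exact: (ler_wpM2l q_ge0 (tail k.+1)).
Qed.

End AntiConcentration.

(** * Random matrices and the law of the model *)

Section Matrices.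
Variables (R : realType) (T : finType) (p : T -> R).

Definition mxrow_ffun m n (X : 'M[T]_(m, n)) (i : 'I_m) : {ffun 'I_n -> T} :=
  [ffun j => X i j].

Definition mxrows m n (X : 'M[T]_(m, n)) : {ffun 'I_m -> {ffun 'I_n -> T}} :=
  [ffun i => mxrow_ffun X i].

(** Makes the marginal lemmas for product distributions applicable to whole rows, the i.i.d.
    coordinates of a nested product. *)
Lemma expect_mxrows m n (G : {ffun 'I_m -> {ffun 'I_n -> T}} -> R) :
  expect (@iid_pmf R T p m n) (fun X => G (mxrows X)) =
  expect (prod_pmf (prod_pmf p)) G.
Proof.
rewrite /expect (reindex (@mxrows m n)) /=; last first.
  exists (fun f : {ffun 'I_m -> {ffun 'I_n -> T}} => \matrix_(i, j) f i j).
    move=> X _.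
    by apply/matrixP => i j; rewrite !(mxE, ffunE).
  by move=> f _; apply/ffunP => i; apply/ffunP => j; rewrite !(mxE, ffunE).
apply: eq_bigr => X _; congr (_ * _); apply: eq_bigr => i _.
by apply: eq_bigr => j _; rewrite !ffunE.
Qed.

(** Letter counts concern columns, whereas the marginals are stated for rows. *)
Lemma expect_trmx m n (F : 'M[T]_(n, m) -> R) :
  expect (@iid_pmf R T p m n) (fun X => F X^T) = expect (@iid_pmf R T p n m) F.
Proof.
rewrite /expect [in RHS](reindex (@trmx T m n)) /=; last first.
  by exists (@trmx T n m) => X _; rewrite trmxK.
apply: eq_bigr => X _; congr (_ * _).
rewrite /iid_pmf exchange_big; apply: eq_bigr => i _; apply: eq_bigr => j _.
by rewrite mxE.
Qed.

Hypothesis p_ge0 : forall t, 0 <= p t.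
Hypothesis p_sum1 : \sum_t p t = 1.

Lemma iid_pmf_ge0 m n (X : 'M[T]_(m, n)) : 0 <= iid_pmf p X.
Proof. by apply: prodr_ge0 => i _; apply: prodr_ge0. Qed.

Lemma iid_pmf_sum1 m n : \sum_(X : 'M[T]_(m, n)) iid_pmf p X = 1.
Proof.
have := @expect_mxrows m n (fun=> 1); rewrite /expect.
under eq_bigr do rewrite mulr1; move=> ->; under eq_bigr do rewrite mulr1.
by rewrite !prod_pmf_sum1.
Qed.

Lemma expect_mxrow m n (i : 'I_m) (h : {ffun 'I_n -> T} -> R) :
  expect (@iid_pmf R T p m n) (fun X => h (mxrow_ffun X i)) =
  expect (prod_pmf p) h.
Proof.
under eq_expect => X do rewrite -[mxrow_ffun X i](ffunE (mxrow_ffun X)).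
rewrite (expect_mxrows (fun f => h (f i))) expect_marginal //.
exact: prod_pmf_sum1.
Qed.

Lemma expect_mxrow2 m n (i i' : 'I_m)
    (h : {ffun 'I_n -> T} -> {ffun 'I_n -> T} -> R) : i != i' ->
  expect (@iid_pmf R T p m n) (fun X => h (mxrow_ffun X i) (mxrow_ffun X i')) =
  expect (prod_pmf p) (fun x => expect (prod_pmf p) (h x)).
Proof.
move=> ii'.
under eq_expect => X do rewrite -[mxrow_ffun X i](ffunE (mxrow_ffun X))
  -[mxrow_ffun X i'](ffunE (mxrow_ffun X)).
rewrite (expect_mxrows (fun f => h (f i) (f i'))) expect_marginal2 //.
exact: prod_pmf_sum1.
Qed.

End Matrices.

(** Merges letters and pattern into one i.i.d. sequence of pairs, to which Chebyshev's inequality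
    applies. *)
Lemma expect_pair (R : realType) (I T U : finType) (p : T -> R) (p' : U -> R)
    (F : {ffun I -> T} -> {ffun I -> U} -> R) :
  expect (prod_pmf p) (fun f => expect (prod_pmf p') (F f)) =
  expect (prod_pmf (fun z => p z.1 * p' z.2))
    (fun h : {ffun I -> T * U} => F [ffun i => (h i).1] [ffun i => (h i).2]).
Proof.
rewrite /expect; under eq_bigr do rewrite big_distrr /=.
rewrite pair_bigA /=.
rewrite (reindex (fun h : {ffun I -> T * U} =>
  ([ffun i => (h i).1] : {ffun I -> T}, [ffun i => (h i).2] : {ffun I -> U})));
  last first.
  exists (fun fg : {ffun I -> T} * {ffun I -> U} =>
    [ffun i => (fg.1 i, fg.2 i)]) => [h|[f g]] _ /=.
    by apply/ffunP => i; rewrite !ffunE -surjective_pairing.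
  by congr (_, _); apply/ffunP => i; rewrite !ffunE.
apply: eq_bigr => h _ /=; rewrite mulrA; congr (_ * _).
by rewrite /prod_pmf -big_split; apply: eq_bigr => i _; rewrite !ffunE.
Qed.

Lemma sum_indicator (R : pzRingType) (T : finType) (t : T) (F : T -> R) :
  \sum_u (u == t)%:R * F u = F t.
Proof.
rewrite (bigD1 t) //= eqxx mul1r big1 ?addr0 // => u /negPf ->.
by rewrite mul0r.
Qed.

(** * The model without obfuscation *)

Section Model.
Variables (R : realType) (q smax : nat).

Definition origin n (S : pattern smax n) (l : 'I_(width S)) : 'I_n :=
  @tagnat.sig1 n (fun j => nat_of_ord (S j)) l.

Lemma origin_copy n (S : pattern smax n) j (t : 'I_(S j)) :
  origin (copy_index t) = j.
Proof. exact: tagnat.Rank1K. Qed.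

Lemma copy_origin n (S : pattern smax n) (l : 'I_(width S)) :
  exists t : 'I_(S (origin l)), l = copy_index t.
Proof.
exists (@tagnat.sig2 n (fun j => nat_of_ord (S j)) l).
by rewrite /copy_index tagnat.sig2K.
Qed.

(** The only possible output without obfuscation. Its row [s i] comes from row [i] of [A], whence
    the inverse permutation. *)
Definition repeat_mx n m (S : pattern smax n) (s : 'S_m) (A : 'M['I_q]_(m, n)) :
  'M['I_q]_(m, width S) := \matrix_(k, l) A ((s^-1)%g k) (origin l).

Lemma repeat_mxE n m (S : pattern smax n) (s : 'S_m) (A : 'M['I_q]_(m, n)) i l :
  repeat_mx S s A (s i) l = A i (origin l).
Proof. by rewrite mxE permK. Qed.

Variable W : 'I_q -> 'I_q -> R.
Hypothesis W_id : forall x y, W x y = (y == x)%:R.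

(** Every column of [B] is some copy, so an entry that differs from [repeat_mx] makes a factor of
    the product vanish. *)
Lemma output_pmfE n m (S : pattern smax n) (s : 'S_m) (A : 'M['I_q]_(m, n)) B :
  output_pmf W s A B = (B == repeat_mx S s A)%:R.
Proof.
rewrite /output_pmf; case: eqP => [->|neqB].
  rewrite big1 // => i _; rewrite big1 // => j _; rewrite big1 // => t _.
  by rewrite W_id repeat_mxE origin_copy eqxx.
have [k /existsP[l neq]] : exists k : 'I_m,
    [exists l, B k l != repeat_mx S s A k l].
  apply/existsP; apply: contra_notT neqB; rewrite negb_exists => /forallP eqB.
  apply/matrixP => k l; have := eqB k; rewrite negb_exists => /forallP/(_ l).
  by rewrite negbK => /eqP.
have [t lt] := copy_origin l.
rewrite (bigD1 ((s^-1)%g k)) //= (bigD1 (origin l)) //= (bigD1 t) //=.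
by rewrite W_id permKV -lt -(repeat_mxE s) permKV (negPf neq) !mul0r.
Qed.

(** The point masses of [output_pmfE] remove the sums over [Y] and [G2]. *)
Lemma error_probE (pX : 'I_q -> R) (pS : 'I_smax.+1 -> R)
    (psi : matching_scheme q) n m L :
  error_prob W pX pS psi n m L =
  expect (prod_pmf pS) (fun S : pattern smax n =>
  expect (@iid_pmf R _ pX m n) (fun X =>
  expect (@iid_pmf R _ pX L n) (fun G =>
  (m`!%:R)^-1 * \sum_(s : 'S_m) (m%:R^-1 * \sum_(i < m)
    (psi n m L (width S) X (repeat_mx S s X) G (repeat_mx S 1%g G) i
       != Some (s i))%:R)))).
Proof.
apply: eq_bigr => S _; rewrite big_distrr; apply: eq_bigr => X _ /=.
rewrite exchange_big !big_distrr; apply: eq_bigr => G _ /=.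
rewrite exchange_big /=.
under eq_bigr => G2 _.
  rewrite exchange_big /=.
  under eq_bigr => s _.
    under eq_bigr => Y _.
      rewrite (_ : \sum_(i < m | _) _ =
        (Y == repeat_mx S s X)%:R * ((G2 == repeat_mx S 1%g G)%:R *
        (prod_pmf pS S * iid_pmf pX X * iid_pmf pX G * (m`!%:R)^-1 * m%:R^-1 *
        \sum_(i < m) (psi n m L (width S) X Y G G2 i != Some (s i))%:R))).
      over.
      rewrite !big_distrr /= big_mkcond; apply: eq_bigr => i _.
      rewrite /joint_pmf !output_pmfE /prod_pmf; case: ifP => _ /=; ring.
    rewrite sum_indicator; over.
  rewrite -big_distrr /=; over.
rewrite sum_indicator !big_distrr /=; apply: eq_bigr => s _; ring.
Qed.

End Model.

(** * Information carried by the surviving letters *)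

Section Information.
Variables (R : realType) (T : finType) (smax n : nat).
Variables (pX : T -> R) (pS : 'I_smax.+1 -> R).
Implicit Types (S : pattern smax n) (x y : {ffun 'I_n -> T}).

(** Self-information of a letter, counted once if its column survives, whatever the number of
    copies: further copies reveal no new letter. *)
Definition letter_info (t : T) (s : 'I_smax.+1) : R :=
  if s == ord0 then 0 else - ln (pX t).

Definition info S x : R := \sum_j letter_info (x j) (S j).

(* The letters of x in the columns that survive the deletions, in place. *)
Definition visible S x : {ffun 'I_n -> option T} :=
  [ffun j => if S j == ord0 then None else Some (x j)].

Definition info_rate : R := (1 - pS ord0) * \sum_t pX t * - ln (pX t).

Definition info_var : R :=
  expect (fun z : T * 'I_smax.+1 => pX z.1 * pS z.2)
    (fun z => (letter_info z.1 z.2 - info_rate) ^+ 2).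

Hypothesis pX_pmf : full_support_pmf pX.
Hypothesis pS_pmf : full_support_pmf pS.

Let pX_gt0 t : 0 < pX t. Proof. by case: pX_pmf. Qed.
Let pX_ge0 t : 0 <= pX t. Proof. exact: ltW. Qed.
Let pX_sum1 : \sum_t pX t = 1. Proof. by case: pX_pmf. Qed.
Let pS_gt0 s : 0 < pS s. Proof. by case: pS_pmf. Qed.
Let pS_sum1 : \sum_s pS s = 1. Proof. by case: pS_pmf. Qed.

(** Chebyshev's inequality for the i.i.d. pairs of a letter and a number of copies. *)
Lemma info_concentration (e : R) : (0 < n)%N -> 0 < e ->
  expect (prod_pmf pS) (fun S => expect (prod_pmf pX) (fun x =>
    (n%:R * e <= `|info S x - n%:R * info_rate|)%R%:R)) <=
  info_var / e ^+ 2 / n%:R.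
Proof.
move=> n0 e0.
have -> : expect (prod_pmf pS) (fun S => expect (prod_pmf pX) (fun x =>
    (n%:R * e <= `|info S x - n%:R * info_rate|)%R%:R)) =
  expect (prod_pmf (fun z : T * 'I_smax.+1 => pX z.1 * pS z.2))
   (fun f : {ffun 'I_n -> T * 'I_smax.+1} => (n%:R * e <=
     `|\sum_i letter_info (f i).1 (f i).2 - n%:R * info_rate|)%R%:R).
  transitivity (expect (prod_pmf pX) (fun x => expect (prod_pmf pS) (fun S =>
    (n%:R * e <= `|info S x - n%:R * info_rate|)%R%:R : R))).
    rewrite /expect; under eq_bigr do rewrite big_distrr /=.
    rewrite exchange_big; apply: eq_bigr => x _; rewrite big_distrr.
    by apply: eq_bigr => S _; rewrite mulrCA.
  rewrite expect_pair; apply: eq_expect => f; rewrite /info.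
  by under eq_bigr do rewrite !ffunE.
have pz_ge0 (z : T * 'I_smax.+1) : 0 <= pX z.1 * pS z.2.
  by rewrite mulr_ge0 // ltW.
have pz_sum1 : \sum_(z : T * 'I_smax.+1) pX z.1 * pS z.2 = 1.
  rewrite -(pair_bigA _ (fun t s => pX t * pS s)) /=.
  by under eq_bigr do rewrite -big_distrr pS_sum1 /= mulr1.
have rateE : expect (fun z : T * 'I_smax.+1 => pX z.1 * pS z.2)
    (fun z => letter_info z.1 z.2) = info_rate.
  rewrite /expect -(pair_bigA _ (fun t s => pX t * pS s * letter_info t s)) /=.
  rewrite /info_rate mulr_sumr; apply: eq_bigr => t _.
  have -> : 1 - pS ord0 = \sum_(s | s != ord0) pS s.
    by rewrite -pS_sum1 [in LHS](bigD1 ord0) //= addrAC subrr add0r.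
  rewrite (bigD1 ord0) //= /letter_info eqxx mulr0 add0r mulr_suml.
  by apply: eq_bigr => s /negPf ->; ring.
have ne0 : 0 < n%:R * e by rewrite mulr_gt0 ?ltr0n.
have := @chebyshev_sum R 'I_n _ _ pz_ge0 pz_sum1
  (fun z => letter_info z.1 z.2) _ ne0.
rewrite rateE card_ord => /le_trans; apply.
rewrite -/info_var le_eqVlt; apply/orP; left; apply/eqP.
by field; rewrite pnatr_eq0 -lt0n n0 gt_eqF.
Qed.

Lemma prod_visible S x :
  \prod_j (if S j == ord0 then 1 else pX (x j)) = expR (- info S x).
Proof.
rewrite -sumrN expR_sum; apply: eq_bigr => j _; rewrite /letter_info.
by case: eqP => _; rewrite ?oppr0 ?expR0 // opprK lnK // posrE.
Qed.

(** The columns are independent: a deleted one always agrees, a surviving one agrees with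
    probability [pX (x j)]. *)
Lemma expect_visible_eq S x :
  expect (prod_pmf pX) (fun y => (visible S y == visible S x)%:R) =
  expR (- info S x).
Proof.
rewrite -prod_visible.
transitivity (\sum_(y : {ffun 'I_n -> T}) \prod_j
    (pX (y j) * ((S j == ord0) || (y j == x j))%:R)).
  apply: eq_bigr => y _; rewrite big_split /=; congr (_ * _).
  case: eqP => [/ffunP eqv|neqv].
    rewrite big1 // => j _; have := eqv j; rewrite !ffunE.
    by case: eqP => //= _ [->]; rewrite eqxx.
  have [j] : exists j, ~~ ((S j == ord0) || (y j == x j)).
    apply/existsP; apply: contra_notT neqv; rewrite negb_exists => /forallP eqv.
    apply/ffunP => j; rewrite !ffunE; have := eqv j; rewrite negbK.
    by case: eqP => //= _ /eqP ->.
  by move=> /negPf nj; rewrite (bigD1 j) //= nj mul0r.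
rewrite -(bigA_distr_bigA
  (fun j t => pX t * ((S j == ord0) || (t == x j))%:R)) /=.
apply: eq_bigr => j _; case: eqP => _ /=.
  by under eq_bigr do rewrite mulr1.
by under eq_bigr do rewrite mulrC; rewrite sum_indicator.
Qed.

(* The sum runs over the distinct visible contents of the rows, each of which
   has probability at least exp (- c). *)
Lemma sum_typical_rows m S (r : 'I_m -> {ffun 'I_n -> T}) (c : R) :
  \sum_i (info S (r i) <= c)%R%:R /
    (#|[set k | visible S (r k) == visible S (r i)]|)%:R <= expR c.
Proof.
(* [w j] is the law of the visible symbol in column [j]. The product weights sum to 1 over all
   contents, and a content of information at most [c] has weight at least exp (- c). *)
pose w (j : 'I_n) (o : option T) : R :=
  if o is Some t then (if S j == ord0 then 0 else pX t) else (S j == ord0)%:R.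
have w_ge0 j o : 0 <= w j o by case: o => [t|] /=; case: eqP.
have w_sum1 : \sum_(u : {ffun 'I_n -> option T}) \prod_j w j (u j) = 1.
  rewrite -(bigA_distr_bigA w) /= big1 // => j _.
  rewrite (bigD1 None) //= (reindex_omap Some id) /=; last by case.
  case: eqP => _; first by rewrite big1 ?addr0 // => t; rewrite ?if_same.
  by rewrite add0r -[RHS]pX_sum1; apply: eq_bigl => t; rewrite eqxx.
have w_visible x : \prod_j w j (visible S x j) = expR (- info S x).
  rewrite -prod_visible; apply: eq_bigr => j _; rewrite /w ffunE.
  by case: eqP.
(* Grouped by content, the [N] rows of a class contribute [N] times 1 / [N] if typical and 0
   otherwise. *)
rewrite (partition_big (fun i => visible S (r i)) predT) //=.
have -> : expR c = \sum_(u : {ffun 'I_n -> option T})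
    expR c * \prod_j w j (u j) by rewrite -mulr_sumr w_sum1 mulr1.
apply: ler_sum => u _.
have [i0 /eqP i0u|no_i] := pickP (fun i => visible S (r i) == u); last first.
  rewrite big_pred0 //; apply: mulr_ge0; first exact: expR_ge0.
  by apply: prodr_ge0 => j _.
have info_u i : visible S (r i) = u -> info S (r i) = info S (r i0).
  by move=> iu; apply: oppr_inj; apply: expR_inj; rewrite -!w_visible iu i0u.
rewrite (eq_bigr (fun=> (info S (r i0) <= c)%R%:R /
    (#|[set k | visible S (r k) == u]|)%:R)); last first.
  by move=> i /eqP iu; rewrite info_u // iu.
rewrite sumr_const -[X in X *+ _]mulr1 -mulrnAr.
have -> : #|[pred i | visible S (r i) == u]| =
    #|[set k | visible S (r k) == u]|.
  by apply: eq_card => k; rewrite !inE.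
rewrite -i0u w_visible -expRD.
set N := #|_|.
have N0 : (0 < N)%N by apply/card_gt0P; exists i0; rewrite inE i0u.
rewrite mulrAC -mulrA mulfV ?pnatr_eq0 -?lt0n // mulr1.
case: (leP _ c) => [le_c|_]; last by rewrite mulr0n expR_ge0.
by rewrite mulr1n -[leLHS]expR0 ler_expR subr_ge0.
Qed.

End Information.

(** * Bounds for finite n *)

(** A column survives exactly when it is the origin of a column of [Y]; copy 0 witnesses this. *)
Lemma visible_eqP (q smax n m : nat) (S : pattern smax n) (X : 'M['I_q]_(m, n))
    (i k : 'I_m) :
  visible S (mxrow_ffun X i) = visible S (mxrow_ffun X k) <->
  forall l : 'I_(width S), X i (origin l) = X k (origin l).
Proof.
split=> [/ffunP eqv l|eqX].
  have [t _] := copy_origin l.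
  have := eqv (origin l); rewrite !ffunE; case: eqP => [S0|_ [] //].
  by move: t; rewrite S0 => -[].
apply/ffunP => j; rewrite !ffunE; case: eqP => // /eqP Sj.
have t0 : (0 < S j)%N by rewrite lt0n.
by have := eqX (copy_index (Ordinal t0)); rewrite origin_copy => ->.
Qed.

(* Answers with a row permutation compatible with some assignment c of the
   columns of Y to columns of X. *)
Definition row_matcher (q : nat) : matching_scheme q :=
  fun n m L K X Y _ _ i =>
  [pick k | [exists s : 'S_m, [exists c : {ffun 'I_K -> 'I_n},
    (s i == k) && [forall i', [forall l, Y (s i') l == X i' (c l)]]]]].

Section Matcher.
Variables (q smax n m : nat).

(** Row permutations preserve the counts of [a] in columns, so distinct counts force every
    compatible [c] to be [origin]. Then rows [i] and [(s^-1)%g (s' i)] of [X] have the same visible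
    letters, hence coincide. The true pair ([s], [origin]) shows that the search does not fail. *)
Lemma row_matcher_correct (S : pattern smax n) (X : 'M['I_q]_(m, n))
    (s : 'S_m) (i : 'I_m) (a : 'I_q) L (G1 : 'M['I_q]_(L, n))
    (G2 : 'M['I_q]_(L, width S)) :
  (forall j j', j != j' ->
    occ a (mxrow_ffun X^T j) != occ a (mxrow_ffun X^T j')) ->
  (forall i', visible S (mxrow_ffun X i') = visible S (mxrow_ffun X i) ->
    i' = i) ->
  row_matcher X (repeat_mx S s X) G1 G2 i = Some (s i).
Proof.
move=> distinct unique; rewrite /row_matcher; case: pickP => [k|no_k].
  case/existsP => s' /existsP[c /andP[/eqP <- /forallP eqY]].
  have {}eqY i' l : repeat_mx S s X (s' i') l = X i' (c l).
    by have /forallP/(_ l)/eqP := eqY i'.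
  have cE l : c l = origin l.
    apply/eqP; apply: contraT => /distinct /negP[]; apply/eqP.
    transitivity (\sum_i (repeat_mx S s X i l == a))%N.
      rewrite (reindex_inj (@perm_inj _ s')) /=; apply: eq_bigr => i' _.
      by rewrite eqY !ffunE mxE.
    rewrite (reindex_inj (@perm_inj _ s)) /=; apply: eq_bigr => i' _.
    by rewrite repeat_mxE !ffunE mxE.
  suff eqi : (s^-1)%g (s' i) = i by rewrite -[in RHS]eqi permKV.
  apply: unique; apply/visible_eqP => l.
  by rewrite -[in RHS]cE -[RHS]eqY mxE.
have := no_k (s i) => /negbT/negP[]; apply/existsP; exists s.
apply/existsP; exists [ffun l => origin l]; rewrite eqxx /=.
by apply/forallP => i'; apply/forallP => l; rewrite repeat_mxE ffunE.
Qed.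

(** If rows [i] and [k] look alike, composing [s] with their transposition leaves [Y] unchanged, so
    a fixed guess is right for [i] as often as for [k]. For each [s] it is right for at most one
    [k], and there are [m]! permutations. *)
Lemma correct_guesses_le (S : pattern smax n) (X : 'M['I_q]_(m, n))
    (g : 'M['I_q]_(m, width S) -> option 'I_m) (i : 'I_m) :
  (#|[set k | visible S (mxrow_ffun X k) == visible S (mxrow_ffun X i)]| *
   \sum_(s : 'S_m) (g (repeat_mx S s X) == Some (s i)) <= m`!)%N.
Proof.
set A := [set k | _].
rewrite -sum_nat_const.
rewrite (eq_bigr (fun k =>
  \sum_(s : 'S_m) (g (repeat_mx S s X) == Some (s k)))%N); last first.
  move=> k; rewrite inE => /eqP/visible_eqP Xki.
  rewrite (reindex_inj (mulgI (tperm i k))) /=; apply: eq_bigr => s _.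
  rewrite permM tpermL; congr (nat_of_bool (g _ == _)).
  apply/matrixP => i' l; rewrite !mxE invMg permM tpermV.
  by case: tpermP => // ->.
rewrite exchange_big /= -(card_Sn m) -sum1_card; apply: leq_sum => s _.
case: (g _) => [y|]; last by rewrite big1.
apply: (@leq_trans (\sum_k (k == (s^-1)%g y))).
  rewrite big_mkcond; apply: leq_sum => k _; case: ifP => // _.
  rewrite (inj_eq (@Some_inj _)) -(inj_eq (@perm_inj _ s) k) permKV.
  by rewrite eq_sym.
by rewrite (bigD1 ((s^-1)%g y)) //= eqxx big1 // => k /negPf ->.
Qed.

End Matcher.

Section FiniteBounds.
Variables (R : realType) (q smax : nat) (W : 'I_q -> 'I_q -> R).
Hypothesis W_id : forall x y, W x y = (y == x)%:R.
Variables (pX : 'I_q -> R) (pS : 'I_smax.+1 -> R).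
Hypothesis pX_pmf : full_support_pmf pX.
Hypothesis pS_pmf : full_support_pmf pS.
Variables (n m L : nat).
Hypothesis m_gt0 : (0 < m)%N.

Let pX_gt0 t : 0 < pX t. Proof. by case: pX_pmf. Qed.
Let pX_ge0 t : 0 <= pX t. Proof. exact: ltW. Qed.
Let pX_sum1 : \sum_t pX t = 1. Proof. by case: pX_pmf. Qed.
Let pS_gt0 s : 0 < pS s. Proof. by case: pS_pmf. Qed.
Let pS_ge0 s : 0 <= pS s. Proof. exact: ltW. Qed.
Let pS_sum1 : \sum_s pS s = 1. Proof. by case: pS_pmf. Qed.
Let m_neq0 : m%:R != 0 :> R. Proof. by rewrite pnatr_eq0 -lt0n. Qed.
Let fact_neq0 : m`!%:R != 0 :> R.
Proof. by rewrite pnatr_eq0 -lt0n fact_gt0. Qed.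

Local Notation ES := (expect (@prod_pmf R 'I_n _ pS)).
Local Notation Ex := (expect (@prod_pmf R 'I_n _ pX)).
Local Notation EX := (expect (@iid_pmf R _ pX m n)).
Local Notation EG := (expect (@iid_pmf R _ pX L n)).
Local Notation row := mxrow_ffun.

Let avg (F : 'I_m -> R) : R := m%:R^-1 * \sum_i F i.

Let avg_cst c : avg (fun=> c) = c.
Proof. by rewrite /avg sumr_const card_ord -[c *+ m]mulr_natl mulKf. Qed.

Let avgS (F : 'S_m -> R) : R := (m`!%:R)^-1 * \sum_s F s.

Let avgS_cst c : avgS (fun=> c) = c.
Proof.
rewrite /avgS sumr_const (_ : #|_| = m`!); last exact: card_Sn.
by rewrite -[c *+ _]mulr_natl mulKf.
Qed.

Let expect_avg (U : finType) (p : U -> R) (F : 'I_m -> U -> R) :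
  expect p (fun u => avg (fun i => F i u)) = avg (fun i => expect p (F i)).
Proof. by rewrite /avg expectZ expect_sum. Qed.

(** The terms bound three causes of error: two columns with equal counts of [a], a row of low
    information, and another row with the same visible letters. *)
Lemma error_row_matcher_le (a : 'I_q) (c : R) : pX a < 1 ->
  error_prob W pX pS (@row_matcher q) n m L <=
  (n * n)%:R / Num.sqrt (m%:R * (pX a * (1 - pX a))) +
  ES (fun S => Ex (fun x => (info pX S x < c)%R%:R)) + m%:R * expR (- c).
Proof.
move=> pa_lt1; rewrite (error_probE W_id).
pose D (X : 'M['I_q]_(m, n)) : R := \sum_(j < n) \sum_(j' < n | j' != j)
  (occ a (row X^T j) == occ a (row X^T j'))%:R.
(* A coincidence is counted only for information at least [c], where it has probability at most exp
   (- c). *)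
pose b (S : pattern smax n) (X : 'M['I_q]_(m, n)) (i : 'I_m) : R :=
  (info pX S (row X i) < c)%R%:R + \sum_(i' < m | i' != i)
   (c <= info pX S (row X i))%R%:R *
   (visible S (row X i') == visible S (row X i))%:R.
have pointwise (S : pattern smax n) X (G : 'M['I_q]_(L, n)) :
    avgS (fun s => avg (fun i =>
    (row_matcher X (repeat_mx S s X) G (repeat_mx S 1%g G) i
       != Some (s i))%:R)) <= D X + avg (b S X).
  rewrite -[leRHS]avgS_cst ler_wpM2l ?invr_ge0 ?ler0n //.
  apply: ler_sum => s _; rewrite -[D X]avg_cst /avg -mulrDr -big_split /=.
  rewrite ler_wpM2l ?invr_ge0 ?ler0n //; apply: ler_sum => i _.
  have D_ge0 : 0 <= D X by apply: sumr_ge0 => j _; apply: sumr_ge0.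
  have b_ge0 : 0 <= b S X i.
    by apply: addr_ge0 => //; apply: sumr_ge0 => i' _; apply: mulr_ge0.
  have [_|err] := eqVneq (row_matcher _ _ _ _ _); first exact: addr_ge0.
  have [/existsP[j /existsP[j' /andP[j'j eq_occ]]]|distinct] := boolP
    [exists j, [exists j', (j' != j) &&
      (occ a (row X^T j) == occ a (row X^T j'))]].
    rewrite -[leLHS]addr0 lerD // /D (bigD1 j) //= (bigD1 j') //= eq_occ.
    rewrite -addrA lerDl addr_ge0 ?sumr_ge0 // => k _.
    by apply: sumr_ge0.
  have [/existsP[i' /andP[i'i eq_vis]]|unique] := boolP [exists i', (i' != i) &&
      (visible S (row X i') == visible S (row X i))].
    rewrite -[leLHS]add0r lerD // /b (bigD1 i') //= eq_vis mulr1 addrA.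
    have -> : (info pX S (row X i) < c)%R%:R +
              (c <= info pX S (row X i))%R%:R = 1 :> R.
      by case: ltP; rewrite ?addr0 ?add0r.
    by rewrite lerDl sumr_ge0 // => k _; rewrite mulr_ge0.
  case/eqP: err; apply: (@row_matcher_correct _ _ _ _ _ _ _ _ a).
    move=> j j' jj'; move: distinct; rewrite negb_exists => /forallP/(_ j).
    by rewrite negb_exists => /forallP/(_ j'); rewrite eq_sym jj'.
  move=> i' eq_vis; move: unique; rewrite negb_exists => /forallP/(_ i').
  by rewrite eq_vis eqxx andbT negbK => /eqP.
have ED : EX D <= (n * n)%:R / Num.sqrt (m%:R * (pX a * (1 - pX a))).
  rewrite expect_sum; under eq_bigr do rewrite expect_sum.
  set K := (Num.sqrt _)^-1.
  have K0 : 0 <= K by rewrite invr_ge0 sqrtr_ge0.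
  apply: (@le_trans _ _ (\sum_(j < n) \sum_(j' < n) K)); last first.
    by rewrite !sumr_const card_ord -mulrnA mulr_natl.
  apply: ler_sum => j _; rewrite big_mkcond; apply: ler_sum => j' _.
  (* After transposition the two columns are independent rows; given one count, the other hits it
     with probability at most [K]. *)
  case: ifP => // j'j; rewrite (expect_trmx pX (fun X : 'M['I_q]_(n, m) =>
    (occ a (row X j) == occ a (row X j'))%:R)).
  rewrite (expect_mxrow2 pX_sum1 (fun x y => (occ a x == occ a y)%:R));
    last by rewrite eq_sym.
  rewrite -(expect_cst (prod_pmf_sum1 'I_m pX_sum1) K).
  apply: ler_expect => x; first exact: prod_pmf_ge0.
  under eq_expect do rewrite eq_sym.
  have := @expect_occ_le R 'I_m _ pX a pX_ge0 pX_sum1 (pX_gt0 a) pa_lt1.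
  by rewrite card_ord; apply.
have Eb S i : EX (fun X => b S X i) <=
    Ex (fun x => (info pX S x < c)%R%:R) + m%:R * expR (- c).
  rewrite expectD (expect_mxrow pX_sum1 i (fun x => (info pX S x < c)%R%:R)).
  rewrite lerD2l expect_sum.
  apply: (@le_trans _ _ (\sum_(i' < m) expR (- c))); last first.
    by rewrite sumr_const card_ord mulr_natl.
  rewrite big_mkcond; apply: ler_sum => i' _; case: ifP => [i'i|_]; last first.
    exact: expR_ge0.
  rewrite (expect_mxrow2 pX_sum1 (fun x y => (c <= info pX S x)%R%:R *
    (visible S y == visible S x)%:R)); last by rewrite eq_sym.
  rewrite -(expect_cst (prod_pmf_sum1 'I_n pX_sum1) (expR (- c))).
  apply: ler_expect => x; first exact: prod_pmf_ge0.
  rewrite expectZ expect_visible_eq //; case: (leP c) => [le_c|_].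
    by rewrite mul1r ler_expR lerN2.
  by rewrite mul0r expR_ge0.
rewrite -addrA -(expect_cst (prod_pmf_sum1 'I_n pS_sum1) (m%:R * expR _)).
rewrite -expectD -(expect_cst (prod_pmf_sum1 'I_n pS_sum1) (_ / _)) -expectD.
apply: ler_expect => S; first exact: prod_pmf_ge0.
apply: (@le_trans _ _ (EX (fun X => D X + avg (b S X)))).
  apply: ler_expect => X; first exact: iid_pmf_ge0.
  rewrite -[leRHS](expect_cst (iid_pmf_sum1 pX_sum1 L n)).
  by apply: ler_expect => G; [exact: iid_pmf_ge0 | exact: pointwise].
rewrite expectD lerD // expect_avg -[leRHS]avg_cst.
by rewrite ler_wpM2l ?invr_ge0 ?ler0n //; apply: ler_sum => i _; exact: Eb.
Qed.

(** A row is guessed with probability at most one over the size of its class. These bounds sum to at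
    most exp [c] over typical rows ([t]); atypical rows ([u]) are conceded. *)
Lemma error_prob_ge (psi : matching_scheme q) (c : R) :
  1 - (expR c / m%:R + ES (fun S => Ex (fun x => (c < info pX S x)%R%:R))) <=
  error_prob W pX pS psi n m L.
Proof.
rewrite (error_probE W_id).
pose t (S : pattern smax n) (X : 'M['I_q]_(m, n)) i : R :=
  (info pX S (row X i) <= c)%R%:R /
  (#|[set k | visible S (row X k) == visible S (row X i)]|)%:R.
pose u (S : pattern smax n) (X : 'M['I_q]_(m, n)) i : R :=
  (c < info pX S (row X i))%R%:R.
have pointwise (S : pattern smax n) X (G : 'M['I_q]_(L, n)) :
  1 - (expR c / m%:R + avg (u S X)) <= avgS (fun s => avg (fun i =>
    (psi n m L (width S) X (repeat_mx S s X) G (repeat_mx S 1%g G) i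
       != Some (s i))%:R)).
  (* With [S], [X] and the seeds fixed, a guess depends on [Y] alone, so [correct_guesses_le]
     applies to any scheme. *)
  set g := fun Y => psi n m L (width S) X Y G (repeat_mx S 1%g G).
  have -> : avgS (fun s => avg (fun i =>
      (g (repeat_mx S s X) i != Some (s i))%:R)) =
    1 - avg (fun i => avgS (fun s =>
      (g (repeat_mx S s X) i == Some (s i))%:R)).
    have -> : avg (fun i => avgS (fun s =>
        (g (repeat_mx S s X) i == Some (s i))%:R)) =
      avgS (fun s => avg (fun i => (g (repeat_mx S s X) i == Some (s i))%:R)).
      by rewrite /avg /avgS -!mulr_sumr mulrCA exchange_big.
    apply/eqP; rewrite eq_sym subr_eq eq_sym -[eqbRHS](avgS_cst 1).
    rewrite /avgS -mulrDr.
    rewrite -big_split /=; apply/eqP; congr (_ * _); apply: eq_bigr => s _.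
    rewrite -[RHS](avg_cst 1) /avg -mulrDr -big_split /=; congr (_ * _).
    by apply: eq_bigr => i _; case: eqP => _; rewrite ?addr0 ?add0r.
  rewrite lerD2l lerN2.
  apply: (@le_trans _ _ (avg (t S X) + avg (u S X))); last first.
    rewrite lerD2r [leRHS]mulrC ler_wpM2l ?invr_ge0 ?ler0n //.
    exact: sum_typical_rows.
  rewrite /avg -mulrDr -big_split ler_wpM2l ?invr_ge0 ?ler0n //=.
  apply: ler_sum => i _; rewrite /t /u.
  case: (leP _ c) => _; last first.
    rewrite mul0r add0r -[leRHS]avgS_cst ler_wpM2l ?invr_ge0 ?ler0n //.
    by apply: ler_sum => s _; case: eqP => _.
  rewrite addr0 mul1r.
  have := @correct_guesses_le _ _ _ _ S X (fun Y => g Y i) i.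
  set N := #|_|.
  have N0 : (0 < N)%N by apply/card_gt0P; exists i; rewrite inE.
  rewrite -(ler_nat R) natrM natr_sum -ler_pdivlMl ?ltr0n // => le_N.
  by rewrite /avgS ler_pdivrMl ?ltr0n ?fact_gt0 // mulrC.
rewrite -[X in 1 - (X + _)](expect_cst (prod_pmf_sum1 'I_n pS_sum1)) -expectD.
rewrite -[X in X - _](expect_cst (prod_pmf_sum1 'I_n pS_sum1)) -mulN1r -expectZ.
rewrite -expectD.
apply: ler_expect => S; first exact: prod_pmf_ge0.
apply: (@le_trans _ _ (EX (fun X => 1 + -1 * (expR c / m%:R + avg (u S X))))).
  rewrite expectD expectZ expectD expect_avg.
  rewrite !(expect_cst (iid_pmf_sum1 pX_sum1 m n)).
  rewrite lerD2l !mulN1r lerN2 lerD2l -[leRHS]avg_cst.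
  rewrite ler_wpM2l ?invr_ge0 ?ler0n //; apply: ler_sum => i _.
  by rewrite /u (expect_mxrow pX_sum1 i (fun x => (c < info pX S x)%R%:R)).
apply: ler_expect => X; first exact: iid_pmf_ge0.
rewrite mulN1r -[leLHS](expect_cst (iid_pmf_sum1 pX_sum1 L n)).
by apply: ler_expect => G; [exact: iid_pmf_ge0 | exact: pointwise].
Qed.

End FiniteBounds.

(** * Asymptotics *)

Local Open Scope classical_set_scope.
Local Open Scope ring_scope.

Lemma cvg0_of_le_inv (R : realType) (f : nat -> R) (K : R) :
  (forall n, 0 <= f n) -> (\forall n \near \oo, f n <= K / n%:R) ->
  f @ \oo --> (0 : R).
Proof.
move=> f_ge0 f_le; apply/cvgrPdist_lt => e e0.
near=> n.
have n0 : (0 < n)%N by near: n; exists 1%N.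
rewrite sub0r normrN ger0_norm //; apply: le_lt_trans (_ : K / n%:R < e).
  by near: n.
rewrite ltr_pdivrMr ?ltr0n // mulrC -ltr_pdivrMr //.
by near: n; exact: nbhs_infty_gtr.
Unshelve. all: by end_near.
Qed.

Lemma ln2_gt0 (R : realType) : 0 < ln 2 :> R.
Proof. by rewrite ln_gt0 // ltr1n. Qed.

Lemma growth_rate_expR (R : realType) (m : nat -> nat) (r e : R) :
  growth_rate m r -> 0 < e -> \forall n \near \oo,
  expR (n%:R * (r * ln 2 - e)) <= (m n)%:R <= expR (n%:R * (r * ln 2 + e)).
Proof.
move=> [m_gt0 m_r] e0.
have l0 := ln2_gt0 R.
(* A tolerance [e / ln 2] in bits is [e] in nats. *)
have /cvgrPdist_le/(_ _ (divr_gt0 e0 l0)) close := m_r.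
near=> n.
have n0 : (0 < n)%N by near: n; exists 1%N.
have m0 : 0 < (m n)%:R :> R by rewrite ltr0n.
have : `|r - log2 (m n)%:R / n%:R| <= e / ln 2 by near: n.
rewrite ler_distlC /log2.
set y := ln (m n)%:R.
have -> : (m n)%:R = expR y by rewrite lnK // posrE.
have -> : y / ln 2 / n%:R = y / (n%:R * ln 2).
  by rewrite -mulrA invfM [_^-1 * _]mulrC.
have nl0 : 0 < n%:R * ln 2 :> R by rewrite mulr_gt0 ?ltr0n.
rewrite ler_pdivlMr // ler_pdivrMr // !ler_expR.
have -> : (r - e / ln 2) * (n%:R * ln 2) = n%:R * (r * ln 2 - e).
  by field; rewrite gt_eqF.
have -> // : (r + e / ln 2) * (n%:R * ln 2) = n%:R * (r * ln 2 + e).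
  by field; rewrite gt_eqF.
Unshelve. all: by end_near.
Qed.

(** Achievability quantifies over all row sizes of rate [r]; the converse needs at least one. *)
Lemma growth_rate_exists (R : realType) (r : R) : 0 < r ->
  exists m, growth_rate m r.
Proof.
move=> r0; have l0 := ln2_gt0 R.
(* The exponential is at least 1, so rounding at most doubles it and shifts the rate by at most 1 /
   [n]. *)
pose m (n : nat) := (Num.truncn (expR (n%:R * (r * ln 2)))).+1.
exists m; split => //; apply/cvgrPdist_lt => e e0.
near=> n.
have n0 : (0 < n)%N by near: n; exists 1%N.
have x0 := expR_ge0 (n%:R * (r * ln 2)).
have /andP[le_x lt_x] := truncn_itv x0.
have m_ge : n%:R * (r * ln 2) <= ln (m n)%:R.
  rewrite -[leLHS]expRK ler_ln ?posrE ?expR_gt0 ?ltr0n //; exact: ltW.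
have m_le : ln (m n)%:R <= ln 2 + n%:R * (r * ln 2).
  rewrite -[X in _ + X]expRK -lnM ?posrE ?expR_gt0 ?ltr0n //.
  rewrite ler_ln ?posrE ?mulr_gt0 ?expR_gt0 ?ltr0n //.
  have : 1 <= expR (n%:R * (r * ln 2)).
    by rewrite -[leLHS]expR0 ler_expR !mulr_ge0 // ltW.
  by rewrite /m -natr1; lra.
have nl0 : 0 < n%:R * ln 2 :> R by rewrite mulr_gt0 ?ltr0n.
rewrite ltr_distlC /log2.
have -> : ln (m n)%:R / ln 2 / n%:R = ln (m n)%:R / (n%:R * ln 2) :> R.
  by rewrite -mulrA invfM [_^-1 * _]mulrC.
rewrite ltr_pdivlMr // ltr_pdivrMr //.
have : e^-1 < n%:R by near: n; exact: nbhs_infty_gtr.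
rewrite -(ltr_pM2l e0) mulfV ?gt_eqF // => en.
apply/andP; split; nra.
Unshelve. all: by end_near.
Qed.

(** * Converse and achievability at the level of rates *)

Section Capacity.
Variables (R : realType) (q smax : nat) (W : 'I_q -> 'I_q -> R).
Hypothesis W_id : forall x y, W x y = (y == x)%:R.
Variables (Lam : nat -> nat) (pX : 'I_q -> R) (pS : 'I_smax.+1 -> R).
Hypothesis pX_pmf : full_support_pmf pX.
Hypothesis pS_pmf : full_support_pmf pS.

Let pX_gt0 t : 0 < pX t. Proof. by case: pX_pmf. Qed.
Let pX_ge0 t : 0 <= pX t. Proof. exact: ltW. Qed.
Let pX_sum1 : \sum_t pX t = 1. Proof. by case: pX_pmf. Qed.
Let pS_gt0 s : 0 < pS s. Proof. by case: pS_pmf. Qed.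
Let pS_ge0 s : 0 <= pS s. Proof. exact: ltW. Qed.
Let pS_sum1 : \sum_s pS s = 1. Proof. by case: pS_pmf. Qed.

Local Notation h := (info_rate pX pS).
Local Notation V := (info_var pX pS).
Local Notation C := ((1 - pS ord0) * entropy pX).

Let delta_le1 : 0 <= 1 - pS ord0.
Proof.
by rewrite -pS_sum1 (bigD1 ord0) //= addrAC subrr add0r sumr_ge0.
Qed.

Let info_rateE : h = C * ln 2.
Proof.
have l0 := ln2_gt0 R.
rewrite /info_rate /entropy -mulrA; congr (_ * _).
rewrite mulNr mulr_suml -sumrN; apply: eq_bigr => t _.
by rewrite /log2; field; rewrite gt_eqF.
Qed.

Let C_ge0 : 0 <= C.
Proof.
have l0 := ln2_gt0 R.
apply: mulr_ge0 => //; rewrite /entropy oppr_ge0; apply: sumr_le0 => t _.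
rewrite mulr_ge0_le0 // /log2 pmulr_lle0 ?invr_gt0 // ln_le0 //.
by rewrite -pX_sum1 (bigD1 t) //= lerDl sumr_ge0.
Qed.

Let info_tail n (e : R) (A : pattern smax n -> {ffun 'I_n -> 'I_q} -> bool) :
  (0 < n)%N -> 0 < e ->
  (forall S x, A S x -> n%:R * e <= `|info pX S x - n%:R * h|) ->
  expect (prod_pmf pS) (fun S => expect (prod_pmf pX) (fun x => (A S x)%:R)) <=
  V / e ^+ 2 / n%:R.
Proof.
move=> n0 e0 A_sub; apply: le_trans (info_concentration pX_pmf pS_pmf n0 e0).
apply: ler_expect => [S|S]; first exact: prod_pmf_ge0.
apply: ler_expect => [x|x]; first exact: prod_pmf_ge0.
by rewrite ler_nat; have := A_sub S x; case: (A S x) => // /(_ isT) ->.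
Qed.

(** From 1 + x <= exp x. Exponential terms are weakened to the order 1 / [n] of the Chebyshev
    terms. *)
Let expRN_le_inv n (e : R) : (0 < n)%N -> 0 < e ->
  expR (- (n%:R * e)) <= e^-1 / n%:R.
Proof.
move=> n0 e0; have ne0 : 0 < n%:R * e by rewrite mulr_gt0 ?ltr0n.
rewrite expRN -invfM lef_pV2 ?posrE ?expR_gt0 // 1?mulrC //.
by have := expR_ge1Dx (n%:R * e); lra.
Qed.

Lemma error_prob_ge0 psi n m L : 0 <= error_prob W pX pS psi n m L.
Proof.
rewrite (error_probE W_id); apply: expect_ge0 => [S|S].
  exact: prod_pmf_ge0.
apply: expect_ge0 => [X|X]; first exact: iid_pmf_ge0.
apply: expect_ge0 => [G|G]; first exact: iid_pmf_ge0.
apply: mulr_ge0; first by rewrite invr_ge0.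
by apply: sumr_ge0 => s _; rewrite mulr_ge0 ?invr_ge0 // sumr_ge0.
Qed.

Lemma achievable_le r : achievable W pX pS Lam r -> r <= C.
Proof.
move=> [r0 ach]; rewrite leNgt; apply/negP => lt_C.
have l0 := ln2_gt0 R.
(* A third of the gap: one part each for the typicality threshold and the growth of [m], and one
   left as the decay exp (- [n] [e]). *)
pose e := (r * ln 2 - h) / 3.
have e0 : 0 < e by rewrite divr_gt0 // subr_gt0 info_rateE ltr_pM2r.
have [m m_r] := growth_rate_exists r0.
have [psi] := ach m m_r.
have half_gt0 : 0 < 2^-1 :> R by rewrite invr_gt0.
move=> /cvgrPdist_lt/(_ _ half_gt0) small.
have m_ge := growth_rate_expR m_r e0.
pose K := e^-1 + V / e ^+ 2.
(* Gives access to a large [n], at which the error is both below 1/2 and at least 1 - [K] / [n],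
   that is at least 1/2. *)
suff [n] : exists n : nat, false by [].
near \oo => n; exists n.
have n0 : (0 < n)%N by near: n; exists 1%N.
have mn0 : (0 < m n)%N by case: m_r.
have : `|0 - error_prob W pX pS psi n (m n) (Lam n)| < 2^-1 by near: n.
rewrite sub0r normrN ger0_norm ?error_prob_ge0 // ltNge => /negP[].
have := error_prob_ge W_id pX_pmf pS_pmf n (Lam n) mn0 psi (n%:R * (h + e)).
apply: le_trans.
have tail : expect (prod_pmf pS) (fun S : pattern smax n =>
    expect (prod_pmf pX) (fun x => (n%:R * (h + e) < info pX S x)%R%:R)) <=
    V / e ^+ 2 / n%:R.
  apply: info_tail => // S x lt_info.
  by rewrite (le_trans _ (ler_norm _)) // lerBrDl -mulrDr ltW.
have few : expR (n%:R * (h + e)) / (m n)%:R <= e^-1 / n%:R.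
  rewrite ler_pdivrMr ?ltr0n //.
  apply: le_trans (_ : expR (- (n%:R * e)) * (m n)%:R <= _); last first.
    by rewrite ler_wpM2r // expRN_le_inv.
  have /andP[lo _] : expR (n%:R * (r * ln 2 - e)) <= (m n)%:R <=
    expR (n%:R * (r * ln 2 + e)) by near: n.
  apply: le_trans (ler_wpM2l (expR_ge0 _) lo).
  rewrite -expRD ler_expR /e le_eqVlt; apply/orP; left; apply/eqP.
  by field.
have Kn : K / n%:R <= 2^-1.
  rewrite ler_pdivrMr ?ltr0n // mulrC ler_pdivlMr ?ltr0n //.
  by rewrite ltW //; near: n; exact: nbhs_infty_gtr.
have : K / n%:R = e^-1 / n%:R + V / e ^+ 2 / n%:R by rewrite mulrDl.
lra.
Unshelve. all: by end_near.
Qed.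

Lemma row_matcher_achieves r : 0 < r -> r < C ->
  achieved_by (@row_matcher q) W pX pS Lam r.
Proof.
move=> r0 lt_C; split=> // m m_r.
have l0 := ln2_gt0 R.
pose e := (h - r * ln 2) / 3.
have e0 : 0 < e by rewrite divr_gt0 // subr_gt0 info_rateE ltr_pM2r.
(* With half the rate as tolerance, [m n] is eventually at least exp ([n] [f]). *)
pose f := r * ln 2 / 2.
have f0 : 0 < f by rewrite divr_gt0 // mulr_gt0.
(* Otherwise every letter has probability at least 1, the entropy is at most 0 and no [r] fits below
   [C]. *)
have [a pa_lt1] : exists a, pX a < 1.
  apply/existsP; apply: contraT; rewrite negb_exists => /forallP p_ge1.
  suff : h <= 0.
    by rewrite leNgt info_rateE mulr_gt0 // (lt_trans r0).
  rewrite /info_rate mulr_ge0_le0 //; apply: sumr_le0 => t _.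
  by rewrite mulr_ge0_le0 // oppr_le0 ln_ge0 // leNgt.
pose k := pX a * (1 - pX a).
have k0 : 0 < k by rewrite mulr_gt0 // subr_gt0.
(* From exp x >= x^6 / 6!: the square root in the collision bound is then at least [n]^3 times that
   of [B], which turns the [n]^2 pairs into order 1 / [n]. *)
pose B := f ^+ 6 / 6`!%:R * k.
have B0 : 0 < B.
  apply: mulr_gt0 k0; apply: divr_gt0; first exact: exprn_gt0.
  by rewrite ltr0n fact_gt0.
pose K := (Num.sqrt B)^-1 + V / e ^+ 2 + e^-1.
have m_itv := growth_rate_expR m_r e0.
have m_ge := growth_rate_expR m_r f0.
apply: (@cvg0_of_le_inv _ _ K) => [n|]; first exact: error_prob_ge0.
near=> n.
have n0 : (0 < n)%N by near: n; exists 1%N.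
have nR0 : 0 < n%:R :> R by rewrite ltr0n.
have mn0 : (0 < m n)%N by case: m_r.
have := error_row_matcher_le W_id pX_pmf pS_pmf n (Lam n) mn0
  (n%:R * (h - e)) pa_lt1.
move=> /le_trans; apply.
rewrite /K !mulrDl; apply: lerD; first apply: lerD.
- have lo : n%:R ^+ 6 * B <= (m n)%:R * k.
    rewrite /B mulrA ler_wpM2r ?(ltW k0) //.
    have /andP[+ _] : expR (n%:R * (r * ln 2 - f)) <= (m n)%:R <=
      expR (n%:R * (r * ln 2 + f)) by near: n.
    apply: le_trans.
    have -> : r * ln 2 - f = f by rewrite /f; field.
    have := @expR_ge1Dxn R (n%:R * f) 5 (mulr_ge0 (ltW nR0) (ltW f0)).
    rewrite exprMn mulrA; apply: le_trans.
    by rewrite lerDr ler01.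
  have sB0 : 0 < Num.sqrt B by rewrite sqrtr_gt0.
  have : n%:R ^+ 3 * Num.sqrt B <= Num.sqrt ((m n)%:R * k).
    have -> : n%:R ^+ 3 * Num.sqrt B = Num.sqrt (n%:R ^+ 6 * B).
      have n3_ge0 : 0 <= n%:R ^+ 3 :> R by apply: exprn_ge0; exact: ltW.
      rewrite (exprM n%:R 3 2) (sqrtrM _ (sqr_ge0 _)) sqrtr_sqr.
      by rewrite (ger0_norm n3_ge0).
    exact: ler_wsqrtr.
  move=> le_s; rewrite natrM -/k.
  have s0 : 0 < n%:R ^+ 3 * Num.sqrt B by rewrite mulr_gt0 ?exprn_gt0.
  apply: le_trans (_ : n%:R * n%:R / (n%:R ^+ 3 * Num.sqrt B) <= _).
    rewrite ler_wpM2l ?mulr_ge0 ?(ltW nR0) // lef_pV2 ?posrE //.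
    exact: lt_le_trans le_s.
  rewrite le_eqVlt; apply/orP; left; apply/eqP.
  by field; rewrite !gt_eqF.
- apply: info_tail => // S x lt_info.
  rewrite -normrN opprB (le_trans _ (ler_norm _)) //.
  by rewrite lerBrDl -lerBrDr -mulrBr ltW.
- have /andP[_ hi] : expR (n%:R * (r * ln 2 - e)) <= (m n)%:R <=
    expR (n%:R * (r * ln 2 + e)) by near: n.
  apply: le_trans (expRN_le_inv n0 e0).
  apply: le_trans (ler_wpM2r (expR_ge0 _) hi) _.
  rewrite -expRD ler_expR /e le_eqVlt; apply/orP; left; apply/eqP.
  by field.
Unshelve. all: by end_near.
Qed.

(** If the supremum were some x < [C], the midpoint of x and [C] would be a larger element of [A];
    it is positive because [rate_sup] is at least 0. *)
Lemma rate_sup_capacity (A : set R) :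
  (forall r, A r -> r <= C) -> (forall r, 0 < r -> r < C -> A r) ->
  rate_sup A = C%:E.
Proof.
move=> A_le A_ge; apply/eqP; rewrite eq_le; apply/andP; split.
  apply: ge_ereal_sup => x [->|[r /A_le le_r <-]]; by rewrite lee_fin.
have ub := @ereal_sup_ubound _ ([set 0%E] `|` [set r%:E | r in A])%classic.
have sup_ge0 : (0 <= rate_sup A)%E by apply: ub; left.
rewrite leNgt; apply/negP => lt_C.
have [x supE] : exists x, rate_sup A = x%:E.
  exists (fine (rate_sup A)); rewrite fineK // ge0_fin_numE //.
  exact: lt_trans lt_C (ltry _).
rewrite supE lte_fin in lt_C; rewrite supE lee_fin in sup_ge0.
have : (((x + C) / 2)%:E <= rate_sup A)%E.
  by apply: ub; right; exists ((x + C) / 2) => //; apply: A_ge; lra.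
by rewrite supE lee_fin; lra.
Qed.

End Capacity.

Theorem theorem2 (R : realType) (q smax : nat) (W : 'I_q -> 'I_q -> R)
    (no_obfuscation : forall x y, W x y = (y == x)%:R)
    (Lam : nat -> nat) :
  agnostic_capacity W Lam
    (fun (pX : 'I_q -> R) (pS : 'I_smax.+1 -> R) =>
       ((1 - pS ord0) * entropy pX)%:E).
Proof.
(* One universal scheme lies below the best tuned one, so a single converse and a single
   construction settle both clauses. *)
have achieved pX pS r :
  achieved_by (@row_matcher q) W pX pS Lam r -> achievable W pX pS Lam r.
  by move=> [r0 ach]; split => // m m_r; exists (@row_matcher q); exact: ach.
split; last exists (@row_matcher q); move=> pX pS pX_pmf pS_pmf;
  apply: rate_sup_capacity => // r.
- exact: achievable_le.
- by move=> r0 lt_C; apply: achieved; exact: row_matcher_achieves.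
- by move=> /achieved; exact: achievable_le.
- exact: row_matcher_achieves.
Qed.
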